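(* Let $D$ be a finite set of integers, all greater than $1$, and let $\mathcal{A} = \{A_d : d \in D\}$ be a collection of arithmetic progressions, where $A_d = a_d + d\mathbb{Z}$ has modulus $d$ (so the moduli are distinct). Suppose that $\mathcal{A}$ covers the integers, i.e. $\bigcup_{d\in D} A_d = \mathbb{Z}$, and let $Q = \mathrm{lcm}(D)$ be the least common multiple of the moduli. Then either $2 \mid Q$, or $9 \mid Q$, or $15 \mid Q$.
   Context: An arithmetic progression with modulus $d$ is a set of the form $a + d\mathbb{Z}$ with $a \in \mathbb{Z}$, $d \in \mathbb{N}$. *)

(* Defs.v *)
From mathcomp Require Import all_boot all_order all_algebra.
From mathcomp Require Import finmap classical_sets.
Set Implicit Arguments.
Unset Strict Implicit.
Unset Printing Implicit Defensive.
Import GRing.Theory.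

Local Open Scope classical_set_scope.

(* The arithmetic progression a + dZ with modulus d. *)
Definition arith_prog (a : int) (d : nat) : set int :=
  [set (a + d%:Z * k)%R | k in [set: int]].

(* The residue a d is only relevant for d in D; indexing the progressions by
   their moduli makes the moduli distinct. *)
Definition covers_integers (D : {fset nat}) (a : nat -> int) : Prop :=
  \bigcup_(d in [set` D]) arith_prog (a d) d = [set: int].

Definition lcm_moduli (D : {fset nat}) : nat := \big[lcmn/1%N]_(d <- D) d.

(* Main.v *)
From Stdlib Require Import BinNat Nnat.
Require Import Defs.
From mathcomp Require Import all_boot all_order all_algebra.
From mathcomp Require Import finmap classical_sets.
From mathcomp Require Import ring lra zify.
Set Implicit Arguments.
Unset Strict Implicit.
Unset Printing Implicit Defensive.
Import Order.TTheory GRing.Theory Num.Theory.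

(* The distortion method. The primes are processed in increasing order. Once those
   below [n] are done there is a weight [w], periodic modulo the [n]-smooth part of
   [Q], that vanishes on every progression whose modulus divides this smooth part,
   together with a lower bound [mu] on the mean of [w] and an upper bound [K] on its
   correlations with pairs of progressions. At a prime [p] the newly covered points
   are removed, and on each fibre the remaining weight is multiplied by
   [1 / max (1 - alpha, 1 - delta)], where [alpha] is the newly covered proportion of
   the fibre. Mass is lost only where [alpha > delta], so by a second moment estimate
   [mu] drops by at most [K / (4 delta (1 - delta) (p - 1)^2)], while [K] grows by the
   factor [1 + (3 p - 1) / ((1 - delta) (p - 1)^2)].

   If [Q] is odd and divisible by neither 9 nor 15, the only primes below 7 are a
   single 3 or a power of 5, which are processed without loss and leave [K = 5/2],
   [mu = 1]. With [delta = 1/4] a computation over the primes up to [2^15] keeps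
   [mu > 3/20]; above that, [n < p <= 2 n] contains at most [2 n / 15] primes since
   their product divides ['C(2 n, n)], and the remaining losses are dominated by a
   geometric series. So [mu > 0] for ever, and some integer is uncovered. *)

(** * Averages *)

Section Average.
Local Open Scope ring_scope.
Variable F : realFieldType.
Implicit Types (N e k x s : nat) (u v : nat -> F).

Definition avg N u : F := N%:R^-1 * \sum_(x < N) u x.

Lemma eq_avg N u v : (forall x, (x < N)%N -> u x = v x) -> avg N u = avg N v.
Proof. by move=> uv; congr (_ * _); apply: eq_bigr => x _; apply: uv. Qed.

Lemma avg_ge0 N u : (forall x, 0 <= u x) -> 0 <= avg N u.
Proof. by move=> u0; rewrite mulr_ge0 ?invr_ge0 ?ler0n ?sumr_ge0. Qed.

Lemma ler_avg N u v : (forall x, (x < N)%N -> u x <= v x) -> avg N u <= avg N v.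
Proof. by move=> uv; rewrite ler_wpM2l ?invr_ge0 ?ler0n ?ler_sum // => x _; apply: uv. Qed.

Lemma avgZ N c u : avg N (fun x => c * u x) = c * avg N u.
Proof. by rewrite /avg -mulr_sumr mulrCA. Qed.

Lemma avgB N u v : avg N (fun x => u x - v x) = avg N u - avg N v.
Proof. by rewrite /avg sumrB mulrBr. Qed.

Lemma avg_const N c : (0 < N)%N -> avg N (fun=> c) = c.
Proof.
move=> N0; rewrite /avg sumr_const card_ord -[c *+ _]mulr_natl mulKf //.
by rewrite pnatr_eq0 -lt0n.
Qed.

Lemma avg_sum N (I : Type) (r : seq I) (u : I -> nat -> F) :
  avg N (fun x => \sum_(i <- r) u i x) = \sum_(i <- r) avg N (u i).
Proof. by rewrite /avg exchange_big mulr_sumr. Qed.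

Lemma avg_fiber N k u :
  avg (N * k) u = avg N (fun x => avg k (fun t => u (x + N * t)%N)).
Proof.
rewrite /avg -mulr_sumr mulrA natrM invfM; congr (_ * _).
rewrite exchange_big /= -(big_mkord predT (fun x => u x)) mulnC big_nat_mul big_mkord.
apply: eq_bigr => t _; rewrite mulSn -{1}[(t * N)%N]add0n big_addn addnK big_mkord.
by apply: eq_bigr => x _; rewrite mulnC.
Qed.

(** As [N] is invertible modulo [e], among [e] consecutive values of [t] at most one puts
    [x + N * t] in the given class. *)
Lemma avg_residue N e k x s : (0 < e)%N -> (0 < k)%N -> coprime N e ->
  avg (e * k) (fun t => (x + N * t == s %[mod e])%N%:R) <= e%:R^-1.
Proof.
move=> e0 k0 Ne; rewrite avg_fiber.
rewrite (@eq_avg _ _ (fun t => (x + N * t == s %[mod e])%N%:R)); last first.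
  move=> t _; rewrite -[RHS](@avg_const k) //; apply: eq_avg => r _.
  by rewrite mulnDr addnA mulnCA -modnDmr modnMr addn0.
rewrite /avg -[leRHS]mulr1 ler_wpM2l ?invr_ge0 ?ler0n //.
rewrite -natr_sum (ler_nat _ _ 1) -(big_mkcond _ (fun=> 1%N)) sum1_card; apply/card_le1_eqP => i j.
rewrite unfold_in => /eqP hi; rewrite unfold_in => /eqP hj; apply/val_inj => /=.
have : (x + N * i == x + N * j %[mod e])%N by rewrite hi hj.
wlog le_ij : i j {hi hj} / (i <= j)%N => [wl|].
  by case/orP: (leq_total i j) => h E; [|symmetry]; apply: wl; rewrite // eq_sym.
rewrite eq_sym eqn_mod_dvd ?leq_add2l ?leq_mul2l ?le_ij ?orbT // subnDl -mulnBr.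
rewrite Gauss_dvdr 1?coprime_sym //.
by rewrite -eqn_mod_dvd // !modn_small // => /eqP.
Qed.

End Average.

(** * Divisors of a number split at one prime *)

Lemma divisors_1 : divisors 1 = [:: 1].
Proof. by []. Qed.

Lemma sum_divisorsM (V : nmodType) N p g (G : nat -> V) :
  prime p -> ~~ (p %| N) ->
  (\sum_(d <- divisors (N * p ^ g)) G d =
   \sum_(j < g.+1) \sum_(m <- divisors N) G (m * p ^ j)%N)%R.
Proof.
move=> p_pr pN.
have N0 : 0 < N by case: N pN; rewrite ?dvdn0.
have p0 := prime_gt0 p_pr.
have cNp : coprime N p by rewrite coprime_sym prime_coprime.
rewrite -(big_mkord predT (fun j => \sum_(m <- divisors N) G (m * p ^ j)%N)%R).
rewrite -big_allpairs_dep; apply/perm_big/uniq_perm.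
- exact: divisors_uniq.
- apply: allpairs_uniq => [||[j m] [k n]]; rewrite ?iota_uniq ?divisors_uniq //.
  move=> /allpairsP[[j' m'] [_ dm [-> ->]]] /allpairsP[[k' n'] [_ dn [-> ->]]] /= E.
  rewrite /= -!dvdn_divisors // in dm dn.
  have Ej l i : l %| N -> logn p (l * p ^ i) = i.
    move=> dl; have l0 := dvdn_gt0 N0 dl.
    rewrite lognM ?expn_gt0 ?p0 // pfactorK // lognE p_pr l0.
    suff -> : (p %| l) = false by [].
    by apply: contraNF pN => /dvdn_trans; apply.
  have jk : j' = k' by rewrite -(Ej m' j') // -(Ej n' k') // E.
  by move/eqP: E; rewrite jk eqn_pmul2r ?expn_gt0 ?p0 // => /eqP ->.
- move=> d; rewrite -dvdn_divisors ?muln_gt0 ?N0 ?expn_gt0 ?p0 //.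
  apply/idP/allpairsP => [dNq|[[j m] /= [lj dm ->]]]; last first.
    rewrite -dvdn_divisors // in dm; rewrite mem_index_iota in lj.
    by rewrite dvdn_mul // dvdn_exp2l // -ltnS.
  (* The part of [d] prime to [p] is [gcdn d N]: the cofactor [e] is coprime to [N %/ gcdn d N],
     hence divides [p ^ g]. *)
  have := dvdn_gcdr d N.
  have [e Ed] := dvdnP (dvdn_gcdl d N).
  have : e %| p ^ g.
    have dgt0 : 0 < gcdn d N by rewrite gcdn_gt0 N0 orbT.
    have cee : coprime (d %/ gcdn d N) (N %/ gcdn d N).
      rewrite /coprime -(eqn_pmul2r dgt0) mul1n muln_gcdl !divnK ?dvdn_gcdl ?dvdn_gcdr //.
    have -> : e = d %/ gcdn d N by apply/eqP; rewrite -(eqn_pmul2r dgt0) -Ed divnK ?dvdn_gcdl.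
    rewrite -(Gauss_dvdr _ cee) -(dvdn_pmul2r dgt0) mulnAC divnK ?dvdn_gcdl //.
    by rewrite divnK ?dvdn_gcdr.
  case/(dvdn_pfactor _ _ p_pr) => j jg Ee dN.
  exists (j, gcdn d N); split; rewrite /= ?mem_index_iota ?ltnS // -?dvdn_divisors //.
  by rewrite mulnC -Ee.
Qed.

(** * Distorting a weight at one prime *)

Section Distortion.
Local Open Scope ring_scope.
Variables (F : realFieldType) (D : pred nat) (r : nat -> nat).

Definition in_class s m x : F := (x == s %[mod m])%N%:R.

Lemma in_class_ge0 s m x : 0 <= in_class s m x.
Proof. exact: ler0n. Qed.

Lemma in_class_le1 s m x : in_class s m x <= 1.
Proof. by rewrite lern1 leq_b1. Qed.

(* [w] is an unnormalised density. Its correlations with pairs of classes are bounded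
   for arbitrary choices [f], [g] of one class per modulus; this form of the bound is
   inherited through a prime by regrouping the moduli [m p^j] by [j]. *)
Record good (N : nat) (K mu : F) (w : nat -> F) : Prop := Good {
  good_ge0 : forall x, 0 <= w x;
  good_periodic : forall x t, w (x + N * t)%N = w x;
  good_uncovered : forall x d, D d -> (d %| N)%N -> x = r d %[mod d] -> w x = 0;
  good_mass : mu <= avg N w;
  good_corr : forall f g : nat -> nat,
    \sum_(m <- divisors N) \sum_(n <- divisors N)
      avg N (fun x => w x * in_class (f m) m x * in_class (g n) n x) <= K }.

Lemma good_corr_ge0 N K mu w : good N K mu w -> 0 <= K.
Proof.
move=> w_good; apply: le_trans _ (good_corr w_good id id).
apply: sumr_ge0 => m _; apply: sumr_ge0 => n _.
by apply: avg_ge0 => x; rewrite !mulr_ge0 ?in_class_ge0 ?(good_ge0 w_good).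
Qed.

Lemma good_mono N K K' mu mu' w :
  K <= K' -> mu' <= mu -> good N K mu w -> good N K' mu' w.
Proof.
move=> KK mumu [w0 per unc mass corr]; split=> //; first exact: le_trans mass.
by move=> f h; apply: le_trans KK.
Qed.

Lemma good_one : (forall d, D d -> (1 < d)%N) -> good 1 1 1 (fun=> 1).
Proof.
move=> D_gt1; split=> //.
- by move=> x d /D_gt1; rewrite dvdn1 => /[swap] /eqP ->.
- by rewrite avg_const.
- by move=> f h; rewrite divisors_1 !big_seq1 (@eq_avg _ 1 _ (fun=> 1)) ?avg_const // => x _;
  rewrite /in_class !modn1 !mulr1.
Qed.

Section Step.
Variables (N p g : nat) (K mu : F) (w : nat -> F) (delta : F).
Hypotheses (p_pr : prime p) (pN : ~~ (p %| N)%N).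
Hypotheses (delta_gt0 : 0 < delta) (delta_lt1 : delta < 1).
Hypothesis w_good : good N K mu w.

Ltac delta_lra := move: delta_gt0 delta_lt1 => ? ?; lra.

Let q := (p ^ g)%N.

Definition newly_covered x : bool :=
  has (fun d => [&& D d, ~~ (d %| N)%N & x == r d %[mod d]]) (divisors (N * q)).

(** This is the proportion [alpha]. Reducing [x] modulo [N] makes it constant on each fibre. *)
Definition density x : F := avg q (fun t => (newly_covered (x %% N + N * t)%N)%:R).

Definition boost (a : F) : F := if a <= delta then (1 - a)^-1 else (1 - delta)^-1.

Definition distort x : F := w x * (~~ newly_covered x)%:R * boost (density x).

Let N_gt0 : (0 < N)%N. Proof. by case: N pN; rewrite ?dvdn0. Qed.
Let p_gt0 : (0 < p)%N. Proof. exact: prime_gt0. Qed.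
Let q_gt0 : (0 < q)%N. Proof. by rewrite expn_gt0 p_gt0. Qed.
Let coNp j : coprime N (p ^ j).
Proof. by rewrite coprimeXr // coprime_sym prime_coprime. Qed.

Lemma density_ge0 x : 0 <= density x.
Proof. by apply: avg_ge0 => t; rewrite ler0n. Qed.

Lemma density_periodic x t : density (x + N * t) = density x.
Proof. by rewrite /density addnC mulnC modnMDl. Qed.

Lemma newly_covered_periodic x t : newly_covered (x + N * q * t) = newly_covered x.
Proof.
apply: eq_in_has => d; rewrite -dvdn_divisors ?muln_gt0 ?N_gt0 // => dNq.
by rewrite -modnDmr (eqP (dvdn_mulr t dNq)) addn0.
Qed.

Lemma boost_ge0 a : 0 <= boost a.
Proof. by rewrite /boost; case: (lerP a delta) => h; rewrite invr_ge0; delta_lra. Qed.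

Lemma boost_le a : boost a <= (1 - delta)^-1.
Proof.
rewrite /boost; case: (lerP a delta) => // h.
by rewrite lef_pV2 ?posrE; delta_lra.
Qed.

Lemma boost_le1 a : (1 - a) * boost a <= 1.
Proof.
rewrite /boost; case: (lerP a delta) => h; first by rewrite mulfV //; delta_lra.
by rewrite ler_pdivrMr; delta_lra.
Qed.

(* In the second case this is [(a - 2 delta)^2 >= 0]. *)
Lemma boost_loss a : 1 - a ^+ 2 / (4 * delta * (1 - delta)) <= (1 - a) * boost a.
Proof.
have dd : 0 < 4 * delta * (1 - delta) by rewrite !mulr_gt0 //; delta_lra.
rewrite /boost; case: (lerP a delta) => h.
  rewrite mulfV; last by delta_lra.
  by rewrite gerBl divr_ge0 ?sqr_ge0 // ltW.
rewrite ler_pdivlMr; last delta_lra.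
have -> : (1 - a ^+ 2 / (4 * delta * (1 - delta))) * (1 - delta) =
  1 - delta - a ^+ 2 / (4 * delta) by field; delta_lra.
rewrite lerBlDr -lerBlDl ler_pdivlMr; last delta_lra.
by have := sqr_ge0 (a - 2 * delta); rewrite expr2; delta_lra.
Qed.

Lemma distort_ge0 x : 0 <= distort x.
Proof. by rewrite !mulr_ge0 ?ler0n ?boost_ge0 ?(good_ge0 w_good). Qed.

Lemma distort_le x : distort x <= (1 - delta)^-1 * w x.
Proof.
rewrite mulrC ler_pM ?mulr_ge0 ?ler0n ?(good_ge0 w_good) ?boost_ge0 ?boost_le //.
by rewrite ler_piMr ?(good_ge0 w_good) // lern1 leq_b1.
Qed.

Lemma distort_periodic x t : distort (x + N * q * t) = distort x.
Proof.
rewrite /distort newly_covered_periodic -mulnA.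
by rewrite (good_periodic w_good) density_periodic.
Qed.

Lemma distort_uncovered x d :
  D d -> (d %| N * q)%N -> x = r d %[mod d] -> distort x = 0.
Proof.
move=> Dd dNq xd; rewrite /distort.
have [dN|ndN] := boolP (d %| N)%N; first by rewrite (good_uncovered w_good Dd dN xd) !mul0r.
suff -> : newly_covered x by rewrite mulr0 mul0r.
apply/hasP; exists d; first by rewrite -dvdn_divisors ?muln_gt0 ?N_gt0.
by rewrite Dd ndN xd eqxx.
Qed.

Lemma fiber_distort x : (x < N)%N ->
  avg q (fun t => distort (x + N * t)) = w x * ((1 - density x) * boost (density x)).
Proof.
move=> xN; rewrite (@eq_avg _ _ _ (fun t => w x * boost (density x) *
   (1 - (newly_covered (x + N * t))%:R))); last first.
  move=> t _; rewrite /distort (good_periodic w_good) density_periodic.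
  by case: newly_covered; rewrite /= ?mulr0 ?mulr1 ?subrr ?subr0 ?mul0r ?mulr0 ?mulr1.
rewrite avgZ avgB avg_const // -mulrA; congr (_ * _); rewrite mulrC; congr ((_ - _) * _).
by rewrite /density modn_small.
Qed.

Lemma fiber_distort_le x : (x < N)%N -> avg q (fun t => distort (x + N * t)) <= w x.
Proof. by move=> xN; rewrite fiber_distort // ler_piMr ?boost_le1 ?(good_ge0 w_good). Qed.

Lemma avg_distort :
  avg (N * q) distort = avg N (fun x => w x * ((1 - density x) * boost (density x))).
Proof. by rewrite avg_fiber; apply: eq_avg => x; apply: fiber_distort. Qed.

Lemma in_classM s m j x t : (m %| N)%N ->
  in_class s (m * p ^ j) (x + N * t) = in_class s m x * in_class s (p ^ j) (x + N * t).
Proof.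
move=> mN; rewrite /in_class chinese_remainder ?(coprime_dvdl mN) //.
have -> : (x + N * t = x %[mod m])%N by rewrite addnC -(divnK mN) mulnAC modnMDl.
by rewrite -natrM mulnb.
Qed.

Lemma fiber_in_class s j x : (j <= g)%N ->
  avg q (fun t => in_class s (p ^ j) (x + N * t)) <= p%:R ^- j.
Proof.
move=> jg; rewrite /q -(subnKC jg) expnD -natrX.
by apply: avg_residue; rewrite ?expn_gt0 ?p_gt0.
Qed.

(* Bounds the relative mass of the distorted weight, within a fibre, of the
   intersection of a class modulo [p^j] with one modulo [p^k]; the fibre mass does not
   increase, so that no factor [1 / (1 - delta)] is needed when [j = k = 0]. *)
Definition corr_weight j k : F :=
  if maxn j k == 0%N then 1 else (1 - delta)^-1 * p%:R ^- maxn j k.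

Lemma fiber_corr s1 s2 j k x : (x < N)%N -> (j <= g)%N -> (k <= g)%N ->
  avg q (fun t => distort (x + N * t) *
    (in_class s1 (p ^ j) (x + N * t) * in_class s2 (p ^ k) (x + N * t)))
  <= corr_weight j k * w x.
Proof.
move=> xN jg kg; rewrite /corr_weight; case: eqP => _.
  rewrite mul1r; apply: le_trans _ (fiber_distort_le xN); apply: ler_avg => t _.
  by rewrite ler_piMr ?distort_ge0 // mulr_ile1 ?in_class_ge0 ?in_class_le1.
(* Of the two classes only the one with the larger exponent is kept. *)
have [s Es] : exists s, forall t,
   in_class s1 (p ^ j) (x + N * t) * in_class s2 (p ^ k) (x + N * t)
   <= in_class s (p ^ maxn j k) (x + N * t).
  have [jk|kj] := leqP j k.
    by exists s2 => t; rewrite ler_piMl ?in_class_ge0 ?in_class_le1.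
  by exists s1 => t; rewrite ler_piMr ?in_class_ge0 ?in_class_le1.
have mg : (maxn j k <= g)%N by rewrite geq_max jg.
have c0 : 0 <= (1 - delta)^-1 * w x.
  by rewrite mulr_ge0 ?(good_ge0 w_good) // invr_ge0; delta_lra.
rewrite mulrAC; apply: le_trans (_ : _ <= _) (ler_wpM2l c0 (fiber_in_class s x mg)).
rewrite -avgZ; apply: ler_avg => t _.
rewrite -(good_periodic w_good x t).
by rewrite ler_pM ?Es ?distort_le ?distort_ge0 ?mulr_ge0 ?in_class_ge0.
Qed.

Lemma distort_corr (f h : nat -> nat) :
  \sum_(m <- divisors (N * q)) \sum_(n <- divisors (N * q))
     avg (N * q) (fun x => distort x * in_class (f m) m x * in_class (h n) n x)
  <= K * \sum_(j < g.+1) \sum_(k < g.+1) corr_weight j k.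
Proof.
rewrite sum_divisorsM // mulr_sumr; apply: ler_sum => j _.
under eq_bigr => m _ do rewrite sum_divisorsM //.
rewrite exchange_big mulr_sumr; apply: ler_sum => k _ /=.
have c0 : 0 <= corr_weight j k.
  rewrite /corr_weight; case: ifP => // _.
  by rewrite mulr_ge0 ?invr_ge0 ?exprn_ge0 ?ler0n //; delta_lra.
rewrite mulrC.
(* For fixed exponents [j] and [k], the residues of the moduli [m * p ^ j] and [n * p ^ k] form new
   choices of one class per divisor of [N]. *)
apply: le_trans _ (ler_wpM2l c0 (good_corr w_good (fun m => f (m * p ^ j)%N)
   (fun n => h (n * p ^ k)%N))).
rewrite mulr_sumr big_seq [leRHS]big_seq; apply: ler_sum => m.
rewrite -dvdn_divisors // => mN; rewrite mulr_sumr big_seq [leRHS]big_seq.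
apply: ler_sum => n; rewrite -dvdn_divisors // => nN.
rewrite avg_fiber -avgZ; apply: ler_avg => x xN.
rewrite (@eq_avg _ _ _ (fun t =>
  (in_class (f (m * p ^ j)%N) m x * in_class (h (n * p ^ k)%N) n x) *
  (distort (x + N * t) * (in_class (f (m * p ^ j)%N) (p ^ j) (x + N * t) *
     in_class (h (n * p ^ k)%N) (p ^ k) (x + N * t))))); last first.
  by move=> t _; rewrite !in_classM //; ring.
rewrite avgZ.
have cc : 0 <= in_class (f (m * p ^ j)%N) m x * in_class (h (n * p ^ k)%N) n x.
  by rewrite mulr_ge0 ?in_class_ge0.
have jg : (j <= g)%N by rewrite -ltnS.
have kg : (k <= g)%N by rewrite -ltnS.
apply: le_trans (ler_wpM2l cc (fiber_corr (f (m * p ^ j)%N) (h (n * p ^ k)%N) xN jg kg)) _.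
by rewrite le_eqVlt; apply/orP; left; apply/eqP; ring.
Qed.

(** A union bound. The exponents start at 1 because a new modulus does not divide [N]. *)
Lemma newly_covered_le y : (newly_covered y)%:R <= \sum_(j < g) \sum_(m <- divisors N)
   in_class (r (m * p ^ j.+1)%N) (m * p ^ j.+1) y.
Proof.
have [/hasP[d]|_] := boolP (newly_covered y); last first.
  by apply: sumr_ge0 => j _; apply: sumr_ge0 => m _; apply: in_class_ge0.
rewrite -dvdn_divisors ?muln_gt0 ?N_gt0 // => dNq /and3P[_ ndN yd].
have := sum_divisorsM g (fun e => (if ~~ (e %| N)%N then in_class (r e) e y else 0)) p_pr pN.
rewrite big_ord_recl [X in _ = X + _]big1_seq ?add0r; last first.
  by move=> m /andP[_]; rewrite -dvdn_divisors // expn0 muln1 => ->.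
under [X in _ = X -> _]eq_bigr => j _.
  under eq_bigr => m _.
    have -> : ~~ (m * p ^ bump 0 j %| N)%N.
      by apply: contra pN; apply: dvdn_trans; rewrite dvdn_mull // expnS dvdn_mulr.
    over.
  over.
move=> <-; rewrite (big_rem d) -?dvdn_divisors ?muln_gt0 ?N_gt0 //= ndN.
rewrite {1}/in_class yd lerDl; apply: sumr_ge0 => e _.
by case: ifP => // _; apply: in_class_ge0.
Qed.

Lemma density_le x : (x < N)%N ->
  density x <= \sum_(j < g) p%:R ^- j.+1 * \sum_(m <- divisors N) in_class (r (m * p ^ j.+1)%N) m x.
Proof.
move=> xN; rewrite /density modn_small //.
apply: le_trans (ler_avg (fun t _ => newly_covered_le _)) _.
rewrite avg_sum; apply: ler_sum => j _; rewrite avg_sum mulr_sumr.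
rewrite big_seq [leRHS]big_seq; apply: ler_sum => m; rewrite -dvdn_divisors // => mN.
rewrite (@eq_avg _ _ _ (fun t => in_class (r (m * p ^ j.+1)%N) m x *
  in_class (r (m * p ^ j.+1)%N) (p ^ j.+1) (x + N * t))); last first.
  by move=> t _; rewrite in_classM.
by rewrite avgZ mulrC ler_wpM2r ?in_class_ge0 // fiber_in_class.
Qed.

Lemma sum_geometric_le : \sum_(j < g) p%:R ^- j.+1 <= (p%:R - 1)^-1 :> F.
Proof.
have p1 : 1 < p%:R :> F by rewrite ltr1n prime_gt1.
suff -> : \sum_(j < g) p%:R ^- j.+1 = (1 - p%:R ^- g) / (p%:R - 1) :> F.
  rewrite ler_pdivrMr ?mulVf; [|lra|lra].
  by rewrite gerBl invr_ge0 exprn_ge0 // ler0n.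
elim: g => [|n IH]; first by rewrite big_ord0 expr0 invr1 subrr mul0r.
rewrite big_ord_recr /= IH exprS; field.
by rewrite expf_neq0 ?gt_eqF //; lra.
Qed.

(** Squaring [density_le] gives, for each pair of exponents, a sum of correlations bounded by [K];
    the geometric coefficients sum to at most [1 / (p - 1)] in each factor. *)
Lemma density_second_moment :
  avg N (fun x => w x * density x ^+ 2) <= K / (p%:R - 1) ^+ 2.
Proof.
have p1 : 1 < p%:R :> F by rewrite ltr1n prime_gt1.
pose S (j : 'I_g) x := \sum_(m <- divisors N) in_class (r (m * p ^ j.+1)%N) m x.
apply: (@le_trans _ _ (avg N (fun x => \sum_(j < g) \sum_(k < g)
    (p%:R ^- j.+1 * p%:R ^- k.+1) * \sum_(m <- divisors N) \sum_(n <- divisors N)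
    (w x * in_class (r (m * p ^ j.+1)%N) m x * in_class (r (n * p ^ k.+1)%N) n x)))).
  apply: ler_avg => x xN.
  apply: (@le_trans _ _ (w x * (\sum_(j < g) p%:R ^- j.+1 * S j x) ^+ 2)).
    rewrite ler_wpM2l ?(good_ge0 w_good) // lerXn2r ?nnegrE ?density_ge0 ?density_le //.
    exact: le_trans (density_ge0 x) (density_le xN).
  rewrite le_eqVlt; apply/orP; left; apply/eqP.
  rewrite expr2 mulr_suml mulr_sumr; apply: eq_bigr => j _.
  rewrite mulr_sumr mulr_sumr; apply: eq_bigr => k _.
  have -> : w x * (p%:R ^- j.+1 * S j x * (p%:R ^- k.+1 * S k x)) =
    p%:R ^- j.+1 * p%:R ^- k.+1 * (w x * S j x * S k x) by ring.
  congr (_ * _); rewrite /S [w x * _]mulr_sumr mulr_suml; apply: eq_bigr => m _.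
  by rewrite mulr_sumr.
have K0 := good_corr_ge0 w_good.
apply: (@le_trans _ _ (\sum_(j < g) \sum_(k < g) (p%:R ^- j.+1 * p%:R ^- k.+1) * K)).
  rewrite avg_sum; apply: ler_sum => j _; rewrite avg_sum; apply: ler_sum => k _.
  rewrite avgZ ler_wpM2l ?mulr_ge0 ?invr_ge0 ?exprn_ge0 ?ler0n //.
  apply: le_trans _ (good_corr w_good (fun m => r (m * p ^ j.+1)%N)
     (fun n => r (n * p ^ k.+1)%N)).
  rewrite avg_sum le_eqVlt; apply/orP; left; apply/eqP; apply: eq_bigr => m _.
  by rewrite avg_sum.
have -> : \sum_(j < g) \sum_(k < g) (p%:R ^- j.+1 * p%:R ^- k.+1) * K =
   K * (\sum_(j < g) p%:R ^- j.+1) ^+ 2.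
  rewrite expr2 mulr_suml mulr_sumr; apply: eq_bigr => j _.
  by rewrite mulr_sumr mulr_sumr; apply: eq_bigr => k _; ring.
rewrite -exprVn ler_wpM2l // lerXn2r ?nnegrE ?sum_geometric_le //; last first.
  by rewrite invr_ge0; delta_lra.
by apply: sumr_ge0 => j _; rewrite invr_ge0 exprn_ge0 ?ler0n.
Qed.

Lemma sum_corr_weight_le :
  \sum_(j < g.+1) \sum_(k < g.+1) corr_weight j k
  <= 1 + (3 * p%:R - 1) / ((p%:R - 1) ^+ 2 * (1 - delta)).
Proof.
have p1 : 1 < p%:R :> F by rewrite ltr1n prime_gt1.
pose c : F := (p%:R - 1) ^+ 2 * (1 - delta).
have c0 : 0 < c by rewrite mulr_gt0 ?exprn_gt0 //; delta_lra.
(* There are [2 i + 1] pairs with [maxn j k = i], and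
   [(3 p - 1) / (p - 1)^2] is the sum of the series [(2 i + 1) / p^i], [i >= 1]. *)
suff -> : \sum_(j < g.+1) \sum_(k < g.+1) corr_weight j k =
   1 + (3 * p%:R - 1) / c - p%:R ^- g * ((2 * g%:R + 3) * p%:R - (2 * g%:R + 1)) / c.
  rewrite gerBl divr_ge0 ?(ltW c0) // mulr_ge0 ?invr_ge0 ?exprn_ge0 ?ler0n //.
  have g0 : 0 <= g%:R :> F := ler0n _ _.
  by move: delta_lt1; nra.
elim: g => [|n IH].
  rewrite !big_ord_recl !big_ord0 /corr_weight /= expr0 invr1 !addr0.
  by field; delta_lra.
rewrite big_ord_recr /= (eq_bigr (fun j : 'I_n.+1 => (\sum_(k < n.+1) corr_weight j k) +
   corr_weight j n.+1)); last by move=> j _; rewrite big_ord_recr.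
rewrite big_split /= IH.
have E (u : 'I_n.+1 -> F) : (forall j, u j = (1 - delta)^-1 * p%:R ^- n.+1) ->
   \sum_(j < n.+1) u j = n.+1%:R * ((1 - delta)^-1 * p%:R ^- n.+1).
  move=> uE; under eq_bigr do rewrite uE.
  by rewrite sumr_const card_ord mulr_natl.
rewrite [X in _ + X]big_ord_recr /= !E; first last.
- by move=> j; rewrite /corr_weight (maxn_idPr _) //= ltnW.
- by move=> j; rewrite /corr_weight (maxn_idPl _) //= ltnW.
rewrite /corr_weight maxnn /= /c (exprS (p%:R : F) n) -[n.+1%:R]natr1; field.
by rewrite expf_neq0 ?gt_eqF //; delta_lra.
Qed.

Lemma good_distort K' mu' :
  K * (\sum_(j < g.+1) \sum_(k < g.+1) corr_weight j k) <= K' ->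
  mu' <= avg (N * q) distort -> good (N * q) K' mu' distort.
Proof.
move=> corr mass; split=> //; [exact: distort_ge0|exact: distort_periodic|
  exact: distort_uncovered|by move=> f h; apply: le_trans (distort_corr f h) corr].
Qed.

Lemma avg_distort_ge :
  mu - K / ((p%:R - 1) ^+ 2 * (4 * delta * (1 - delta))) <= avg (N * q) distort.
Proof.
rewrite avg_distort invfM mulrA.
have dd : 0 < 4 * delta * (1 - delta) by rewrite !mulr_gt0 //; delta_lra.
apply: le_trans (_ : avg N w - (avg N (fun x => w x * density x ^+ 2)) /
   (4 * delta * (1 - delta)) <= _).
  rewrite lerB ?(good_mass w_good) // ler_wpM2r ?density_second_moment //.
  by rewrite invr_ge0 ltW.
rewrite mulrC -avgZ -avgB; apply: ler_avg => x _.
rewrite mulrCA [_^-1 * _]mulrC -{1}[w x]mulr1 -mulrBr.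
by rewrite ler_wpM2l ?(good_ge0 w_good) ?boost_loss.
Qed.

(** Below the threshold the boost restores exactly the mass removed from the fibre. *)
Lemma avg_distort_lossless : (forall x, (x < N)%N -> density x <= delta) ->
  mu <= avg (N * q) distort.
Proof.
move=> le_delta; apply: le_trans (good_mass w_good) _.
rewrite avg_distort; apply: ler_avg => x /le_delta dx.
by rewrite /boost dx mulfV ?mulr1 //; delta_lra.
Qed.

Lemma density_le_delta : N = 1%N -> \sum_(j < g) p%:R ^- j.+1 <= delta ->
  forall x, (x < N)%N -> density x <= delta.
Proof.
move=> N1 le_delta x xN; apply: le_trans (density_le xN) (le_trans _ le_delta).
apply: ler_sum => j _; rewrite N1 divisors_1 big_seq1 ler_piMr ?in_class_le1 //.
by rewrite invr_ge0 exprn_ge0 ?ler0n.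
Qed.

End Step.
End Distortion.

(** * Primes between n and 2n *)

Definition pcount n m := \sum_(n <= p < m | prime p) 1.

Lemma prime_dvd_fact p n : prime p -> p %| n`! -> p <= n.
Proof.
move=> p_pr; elim: n => [|n IH]; first by rewrite Euclid_dvd1.
by rewrite factS Euclid_dvdM // => /orP[/dvdn_leq -> //|/IH /leqW].
Qed.

Lemma prod_primes_dvd_central_bin n m : m <= n ->
  \prod_(n.+1 <= p < n.+1 + m | prime p) p %| 'C(n.*2, n).
Proof.
elim: m => [|m IH] mn; first by rewrite addn0 big_geq // dvd1n.
rewrite addnS big_mkcond big_nat_recr ?leq_addr //= -big_mkcond /=.
case: ifP => p_pr; last by rewrite muln1 IH // ltnW.
rewrite Gauss_dvd ?IH 1?ltnW //=; last first.
  rewrite coprime_sym prime_coprime // Euclid_dvd_prod // big_has_cond /=.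
  apply/hasPn => q; rewrite mem_index_iota => /andP[nq qm].
  by apply/negP => /andP[q_pr /dvdn_leq]; rewrite prime_gt0 // => /(_ isT); lia.
(* A prime in this range divides [(2 n)!], the product of the binomial and two copies of [n!], but
   exceeds [n] and so cannot divide [n!]. *)
have : n.+1 + m %| (n.*2)`! by apply: dvdn_fact; lia.
rewrite -(@bin_fact n.*2 n) -?addnn ?leq_addr // addnK !Euclid_dvdM //.
by case/or3P => // /prime_dvd_fact -/(_ p_pr); lia.
Qed.

Lemma leq_central_bin n : 'C(n.*2, n) <= 2 ^ n.*2.
Proof.
rewrite (expnDn 1 1); have nn : n < n.*2.+1 by lia.
by rewrite (bigD1 (Ordinal nn)) //= !exp1n !muln1 leq_addr.
Qed.

(** Each prime counted exceeds [2 ^ k], while their product is at most [2 ^ n.*2]. *)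
Lemma pcount_le k n : 2 ^ k <= n -> k * pcount n.+1 n.*2.+1 <= n.*2.
Proof.
move=> kn; rewrite -(@leq_exp2l 2) // expnM.
apply: leq_trans (leq_central_bin n).
have C0 : 0 < 'C(n.*2, n) by rewrite bin_gt0 -addnn leq_addr.
apply: leq_trans (dvdn_leq C0 (prod_primes_dvd_central_bin (leqnn n))).
rewrite addSn addnn /pcount expn_sum big_nat_cond [leqRHS]big_nat_cond.
apply: leq_prod => p /andP[/andP[np _] _]; rewrite expn1.
exact: leq_trans kn (ltnW np).
Qed.

(** * Processing the primes in order *)

Section Reach.
Local Open Scope ring_scope.
Variables (F : realFieldType) (D : pred nat) (r : nat -> nat) (Q : nat).
Hypothesis D_gt1 : forall d, D d -> (1 < d)%N.
Hypothesis Q_gt0 : (0 < Q)%N.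

(** The inequality is strict: [reach p] is the state before [p] is processed and [reach p.+1] the
    state after. *)
Definition smooth_part n := (Q`_[pred p | p < n])%N.

Definition reach n (K mu : F) := exists w : nat -> F, good D r (smooth_part n) K mu w.

Lemma reach_mono n K K' mu mu' : K <= K' -> mu' <= mu -> reach n K mu -> reach n K' mu'.
Proof. by move=> KK mumu [w w_good]; exists w; apply: good_mono w_good. Qed.

Lemma smooth_part_skip n : ~~ (prime n && (n %| Q)%N) -> smooth_part n.+1 = smooth_part n.
Proof.
move=> nQ; apply: eq_in_partn => p; rewrite mem_primes => /and3P[p_pr _ pQ].
rewrite !inE ltnS leq_eqVlt; case: eqP => // Ep.
by rewrite -Ep p_pr pQ in nQ.
Qed.

Lemma smooth_part_prime p : prime p ->
  smooth_part p.+1 = (smooth_part p * p ^ logn p Q)%N.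
Proof.
move=> p_pr; rewrite /smooth_part -p_part -[LHS](partnC p (part_gt0 [pred l | (l < p.+1)%N] Q)) mulnC.
rewrite -!partnI; congr (_ * _)%N; apply: eq_partn => l; rewrite !inE /=.
  by rewrite ltnS leq_eqVlt; case: ltngtP.
by case: eqP => [->|]; rewrite ?ltnSn ?andbF.
Qed.

Lemma smooth_part_ndvd p : prime p -> ~~ (p %| smooth_part p)%N.
Proof.
move=> p_pr; apply/negP => pN.
have /pnatP : [pred l | (l < p)%N].-nat (smooth_part p) := part_pnat _ _.
by move=> /(_ (part_gt0 _ _) p p_pr pN); rewrite !inE ltnn.
Qed.

(** With [delta = 1/4] both [1 - delta] and [4 * delta * (1 - delta)] equal [3/4]. *)
Lemma reach_prime p K mu : prime p -> reach p K mu ->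
  reach p.+1 (K * (1 + (3 * p%:R - 1) / ((p%:R - 1) ^+ 2 * (3 / 4))))
    (mu - K / ((p%:R - 1) ^+ 2 * (3 / 4))).
Proof.
move=> p_pr [w w_good]; rewrite /reach smooth_part_prime //.
have d0 : 0 < 1 / 4 :> F by lra.
have d1 : 1 / 4 < 1 :> F by lra.
have pN := smooth_part_ndvd p_pr.
eexists; apply: (good_distort p_pr pN d0 d1 w_good).
- apply: (ler_wpM2l (good_corr_ge0 w_good)).
  apply: le_trans (sum_corr_weight_le _ p_pr d0 d1) _.
  by rewrite (_ : 1 - 1 / 4 = 3 / 4 :> F) //; field.
- apply: le_trans _ (avg_distort_ge _ p_pr pN d0 d1 w_good).
  by rewrite (_ : 4 * (1 / 4) * (1 - 1 / 4) = 3 / 4 :> F) //; field.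
Qed.

Lemma reach_skip n K mu : ~~ (prime n && (n %| Q)%N) -> reach n K mu -> reach n.+1 K mu.
Proof. by move=> nQ; rewrite /reach smooth_part_skip. Qed.

Lemma smooth_part2 : smooth_part 2 = 1%N.
Proof.
apply/eqP; rewrite partn_eq1 //; apply/pnatP => // p p_pr _.
by rewrite !inE -leqNgt prime_gt1.
Qed.

Lemma reach_7 : ~~ (2 %| Q)%N -> ~~ (9 %| Q)%N -> ~~ (15 %| Q)%N -> reach 7 (5 / 2) 1.
Proof.
move=> Q2 Q9 Q15.
have N3 : smooth_part 3 = 1%N by rewrite smooth_part_skip ?smooth_part2 ?(negPf Q2) ?andbF.
have [Q3|nQ3] := boolP (3 %| Q)%N.
  have Q5 : ~~ (5 %| Q)%N.
    by apply: contra Q15 => Q5; rewrite (_ : 15 = 3 * 5)%N // Gauss_dvd // Q3.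
  have l3 : logn 3 Q = 1%N.
    apply/eqP; rewrite eqn_leq -(pfactor_dvdn 1) // Q3 andbT leqNgt.
    by rewrite -(pfactor_dvdn 2).
  do 3 (apply: reach_skip; first by rewrite ?(negPf Q5) ?andbF).
  rewrite /reach smooth_part_prime // N3 l3.
  (* One class modulo 3 has density at most [1/3], so [delta = 1/3] loses nothing; [K] becomes
     [1 + 3 * (3/2) * (1/3) = 5/2]. *)
  have d0 : 0 < 1 / 3 :> F by lra.
  have d1 : 1 / 3 < 1 :> F by lra.
  have w_good : good D r 1 1 1 (fun=> 1 : F) := good_one F r D_gt1.
  eexists; apply: (good_distort (isT : prime 3) (isT : ~~ (3 %| 1)%N) d0 d1 w_good).
    rewrite !big_ord_recl !big_ord0 /corr_weight /= /bump /=.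
    by rewrite le_eqVlt; apply/orP; left; apply/eqP; field.
  apply: (avg_distort_lossless (isT : prime 3) d0 d1 w_good).
  apply: density_le_delta => //.
  by rewrite big_ord_recl big_ord0 /=; lra.
apply: reach_skip => //.
have N5 : smooth_part 5 = 1%N.
  by rewrite smooth_part_skip // smooth_part_skip ?N3 ?(negPf nQ3) ?andbF.
rewrite /reach smooth_part_prime // N5.
(* All powers of 5 together have density at most [1 / (5 - 1) = 1/4]; [K] is at most
   [13/6 < 5/2]. *)
have d0 : 0 < 1 / 4 :> F by lra.
have d1 : 1 / 4 < 1 :> F by lra.
have w_good : good D r 1 1 1 (fun=> 1 : F) := good_one F r D_gt1.
eexists; apply: (good_distort (isT : prime 5) (isT : ~~ (5 %| 1)%N) d0 d1 w_good).
  rewrite mul1r; apply: le_trans (sum_corr_weight_le _ (isT : prime 5) d0 d1) _.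
  rewrite (_ : 1 + _ = 13 / 6 :> F); [lra | by field].
apply: (avg_distort_lossless (isT : prime 5) d0 d1 w_good).
apply: density_le_delta => //.
apply: le_trans (sum_geometric_le _ _ (isT : prime 5)) _.
by rewrite le_eqVlt; apply/orP; left; apply/eqP; field.
Qed.

End Reach.

(** * Numerical computation up to [2^15] *)

(** Trial division on binary numbers, for fast evaluation. A divisor equal to [n] is let through, so
    that the listed primes pass. *)
Fixpoint no_small_divisor (s : seq BinNums.N) (n : BinNums.N) : bool :=
  if s is d :: s' then
    if N.eqb (N.modulo n d) 0%num then N.eqb n d && no_small_divisor s' n
    else no_small_divisor s' n
  else true.

Lemma no_small_divisor_prime s n : all (fun d => N.ltb 1 d) s ->
  prime (N.to_nat n) -> no_small_divisor s n.
Proof.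
move=> s_gt1 n_pr; elim: s s_gt1 => //= d s IH /andP[/N.ltb_spec0 d1 /IH ->].
case: N.eqb_spec => // /N.Div0.mod_divides [c Ec]; rewrite andbT; apply/N.eqb_spec.
have dn : N.to_nat d %| N.to_nat n by apply/dvdnP; exists (N.to_nat c); rewrite Ec; lia.
by move/(prime_nt_dvdP n_pr): dn => dn; apply: N2Nat.inj; rewrite dn //; lia.
Qed.

Definition small_primes : seq BinNums.N :=
  [:: 2; 3; 5; 7; 11; 13; 17; 19; 23; 29; 31; 37; 41; 43; 47; 53; 59; 61; 67; 71; 73; 79]%num.

(* A state [(m, k, l)] stands for [K = k / scale] and [mu = 1 - l / scale] after the
   primes up to [m], with [k] and [l] rounded up. Composite numbers without a prime
   factor below 80 are also charged for, which is harmless. *)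
Definition scale : BinNums.N := 1000000%num.

(** The update of [reach_prime] at [p = m + 1], where [3 p - 1 = 3 m + 2] and [p - 1 = m]; [N.succ]
    of a floored quotient rounds it up. *)
Definition sieve_step (s : BinNums.N * BinNums.N * BinNums.N) :=
  let '(m, k, l) := s in
  let n := N.succ m in
  if no_small_divisor small_primes n then
    let e := (3 * m * m)%num in
    (n, N.succ (k + 4 * k * (3 * m + 2) / e), N.succ (l + 4 * k / e))%num
  else (n, k, l).

(* [mu >= 1 / 100 + 5 / 2 * K / m], the bound maintained when [m] is doubled. *)
Definition sieve_check (s : BinNums.N * BinNums.N * BinNums.N) : bool :=
  let '(m, k, l) := s in
  N.leb 32768 m && N.leb (100 * l * m + 250 * k)%num (99 * scale * m)%num.

(** The run starts from [K = 5/2], [mu = 1] after 6, and [6 + 32762 = 2^15]. *)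
Lemma sieve_run_check : sieve_check (N.iter 32762 sieve_step (6, 2500000, 0))%num.
Proof. by vm_compute. Qed.

Section Tail.
Local Open Scope ring_scope.
Variable F : realFieldType.

Let c (n : BinNums.N) : F := (N.to_nat n)%:R.

Lemma natN_div_le a b : b <> 0%num -> c a / c b <= c (N.succ (a / b)%num).
Proof.
move=> b0; have bF : 0 < c b by rewrite ltr0n; lia.
rewrite ler_pdivrMr // -natrM ler_nat.
have := N.mul_succ_div_gt a b b0.
set q := (a / b)%num; lia.
Qed.

Variables (D : pred nat) (r : nat -> nat) (Q : nat).
Notation reach := (@reach F D r Q).

Lemma reach_sieve_step (S : F) m k l : 0 < S -> (0 < N.to_nat m)%N ->
  reach (N.to_nat m).+1 (c k / S) (1 - c l / S) ->
  let '(m', k', l') := sieve_step (m, k, l) in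
  (0 < N.to_nat m')%N /\ reach (N.to_nat m').+1 (c k' / S) (1 - c l' / S).
Proof.
move=> S0 m0 R0; rewrite /sieve_step.
have Em : N.to_nat (N.succ m) = (N.to_nat m).+1 by lia.
case: ifP => [_|np]; rewrite Em; split=> //; last first.
  apply: reach_skip => //; apply/negP => /andP[n_pr _].
  by rewrite no_small_divisor_prime ?Em in np.
have [n_pr|n_npr] := boolP (prime (N.to_nat m).+1).
  clear Em; have m0F : 0 < c m by rewrite ltr0n.
  have e0 : (3 * m * m)%num <> 0%num by lia.
  have Ee : c (3 * m * m)%num = 3 * c m * c m by rewrite /c -!natrM; congr (_%:R); lia.
  have E1 : (N.to_nat m).+1%:R - 1 = c m by rewrite -natr1 addrK.
  have E2 : (N.to_nat m).+1%:R = c m + 1 by rewrite natr1.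
  have := reach_prime n_pr R0; rewrite E1 E2; apply: reach_mono.
  - have := natN_div_le (4 * k * (3 * m + 2))%num e0.
    rewrite Ee (_ : c (4 * k * (3 * m + 2))%num = 4 * c k * (3 * c m + 2)); last first.
      by rewrite /c -!(natrM, natrD); congr (_%:R); lia.
    set q := (_ / _)%num => qle.
    rewrite (_ : c (N.succ (k + q)) = c k + c (N.succ q)); last first.
      by rewrite /c -natrD; congr (_%:R); lia.
    have -> : c k / S * (1 + (3 * (c m + 1) - 1) / (c m ^+ 2 * (3 / 4))) =
      (c k + 4 * c k * (3 * c m + 2) / (3 * c m * c m)) / S by field; lra.
    by rewrite ler_wpM2r ?invr_ge0 ?(ltW S0) // lerD2l.
  - have := natN_div_le (4 * k)%num e0.
    rewrite Ee (_ : c (4 * k)%num = 4 * c k); last first.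
      by rewrite /c -!(natrM, natrD); congr (_%:R); lia.
    set q := (_ / _)%num => qle.
    rewrite (_ : c (N.succ (l + q)) = c l + c (N.succ q)); last first.
      by rewrite /c -natrD; congr (_%:R); lia.
    have -> : 1 - c l / S - c k / S / (c m ^+ 2 * (3 / 4)) =
      1 - (c l + 4 * c k / (3 * c m * c m)) / S by field; lra.
    by rewrite lerB // ler_wpM2r ?invr_ge0 ?(ltW S0) // lerD2l.
(* A composite that passed the trial division: the charge only weakens the bounds. *)
apply: (@reach_mono F D r Q _ (c k / S) _ (1 - c l / S)).
- rewrite ler_wpM2r ?invr_ge0 ?(ltW S0) // ler_nat.
  by set q := (_ / _)%num; lia.
- rewrite lerB // ler_wpM2r ?invr_ge0 ?(ltW S0) // ler_nat.
  by set q := (_ / _)%num; lia.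
- by apply: reach_skip => //; rewrite negb_and n_npr.
Qed.

Lemma reach_sieve : reach 7 (5 / 2) 1 -> exists (K : F) (n : nat),
  [/\ 0 <= K, (2 ^ 15 <= n)%N & reach n.+1 K (1 / 100 + 5 / 2 * K / n%:R)].
Proof.
move=> R7.
(* [S] is kept abstract: unification could otherwise expand [N.to_nat scale] in unary. *)
have [S ES] : exists S, S = c scale by exists (c scale).
have S0 : 0 < S by rewrite ES ltr0n /scale; lia.
pose P (s : BinNums.N * BinNums.N * BinNums.N) := let '(m, k, l) := s in
  (0 < N.to_nat m)%N /\ reach (N.to_nat m).+1 (c k / S) (1 - c l / S).
have P_step s : P s -> P (sieve_step s).
  by case: s => [[m k] l] [m0 R0]; apply: reach_sieve_step.
have P_init : P (6, 2500000, 0)%num.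
  have k0 : 5 / 2 <= c 2500000%num / S.
    by rewrite ler_pdivlMr // mulrAC ler_pdivrMr ?ltr0n // ES -!natrM ler_nat /scale; lia.
  split; first by [].
  move: k0; set k := c _ => k0.
  by apply: (reach_mono k0 _ R7); rewrite mul0r subr0.
have P_iter n : P (N.iter n sieve_step (6, 2500000, 0)%num) by exact: N.iter_invariant.
move: sieve_run_check (P_iter 32762%num).
case: (N.iter _ _ _) => [[m k] l] /andP[/N.leb_spec0 m_ge /N.leb_spec0 chk] [m0 R].
exists (c k / S), (N.to_nat m); split; first by rewrite divr_ge0 ?ler0n // ltW.
  lia.
have m0F : 0 < c m by rewrite ltr0n.
apply: (reach_mono _ _ R) => //; rewrite -/(c m).
have : 100 * c l * c m + 250 * c k <= 99 * S * c m.
  by rewrite ES -!(natrM, natrD) ler_nat; lia.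
rewrite -subr_ge0 => chkF; rewrite -subr_ge0.
have -> : 1 - c l / S - (1 / 100 + 5 / 2 * (c k / S) / c m) =
  (99 * S * c m - (100 * c l * c m + 250 * c k)) / (100 * S * c m).
  by field; lra.
by rewrite divr_ge0 // !mulr_ge0 ?ler0n // ltW.
Qed.

(** * Doubling the range beyond [2^15] *)

Lemma expr_1D_ge (x : F) n : 0 <= x -> 1 + n%:R * x <= (1 + x) ^+ n.
Proof.
move=> x0; elim: n => [|n IH]; first by rewrite expr0 mul0r addr0.
rewrite exprS; apply: le_trans (_ : (1 + x) * (1 + n%:R * x) <= _).
  have n0 : 0 <= n%:R :> F := ler0n _ _.
  by rewrite -natr1; nra.
by rewrite ler_wpM2l // addr_ge0.
Qed.

(** Induction, from [(1 + x) (1 - (n + 1) x) <= 1 - n x]. *)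
Lemma expr_1D_le (x : F) n : 0 <= x -> (1 + x) ^+ n * (1 - n%:R * x) <= 1.
Proof.
move=> x0; elim: n => [|n IH]; first by rewrite expr0 mul0r subr0 mulr1.
apply: le_trans IH; rewrite exprS mulrAC mulrC.
rewrite ler_wpM2l ?exprn_ge0 ?addr_ge0 // -natr1.
have n0 : 0 <= n%:R :> F := ler0n _ _.
by nra.
Qed.

Section Doubling.
Variables (n : nat) (K mu : F).
Hypothesis n_ge : (2 ^ 15 <= n)%N.
Hypothesis K_ge0 : 0 <= K.

(* Dominates the relative growth of [K] at any prime above [n]. *)
Let cost : F := 401 / 100 / n%:R.

Let nF_ge : 300 <= n%:R :> F.
Proof.
apply: (@le_trans _ _ (2 ^+ 15)); first by lra.
by rewrite -natrX ler_nat.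
Qed.

Lemma pcount_doubling : (pcount n.+1 n.*2.+1)%:R <= 2 / 15 * n%:R :> F.
Proof.
have := pcount_le n_ge; rewrite -(ler_nat F) natrM -muln2 natrM.
by move=> ?; lra.
Qed.

Lemma expr_cost_le j : (j <= pcount n.+1 n.*2.+1)%N -> (1 + cost) ^+ j <= 7 / 4.
Proof.
rewrite -(ler_nat F) => /le_trans/(_ pcount_doubling) jn.
have n_ge' := nF_ge.
have c0 : 0 <= cost by rewrite divr_ge0; lra.
(* The product is at most [(2/15) (401/100) / 8 < 0.0669]. *)
have jc : j%:R * (cost / 8) <= 67 / 1000.
  by rewrite /cost !mulrA !ler_pdivrMr; lra.
set x := cost / 8 in jc.
have x0 : 0 <= x by rewrite divr_ge0.
(* [expr_1D_le] for [cost] itself would give a factor above 2, which is not enough for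
   convergence; it is applied to [x], and the result raised to the eighth power. *)
have x8 : 1 + cost <= (1 + x) ^+ 8.
  have -> : cost = 8 * x by rewrite /x mulrC divfK //; lra.
  exact: expr_1D_ge.
(* Here [1 / (1 - 67/1000) < 134/125]; three squarings, the first rounded up to [23/20], then stay
   below [7/4]. *)
have y_le : (1 + x) ^+ j <= 134 / 125.
  have := expr_1D_le j x0; have : 0 <= (1 + x) ^+ j by rewrite exprn_ge0; lra.
  by nra.
apply: le_trans (_ : ((1 + x) ^+ 8) ^+ j <= _).
  by rewrite lerXn2r ?nnegrE ?exprn_ge0; lra.
rewrite -exprM mulnC exprM; set y := (1 + x) ^+ j in y_le *.
have y0 : 0 <= y by rewrite exprn_ge0; lra.
have y2 : y ^+ 2 <= 23 / 20 by rewrite expr2; nra.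
have y4 : y ^+ 4 <= 529 / 400.
  by rewrite (exprM _ 2 2) expr2; have := sqr_ge0 y; nra.
rewrite (exprM _ 4 2) expr2; have : 0 <= y ^+ 4 by rewrite exprn_ge0.
by nra.
Qed.

(** Throughout the doubling the correlation bound stays below [7/4 * K], so every prime can be
    charged the same loss. *)
Lemma reach_partial m : (m <= n)%N -> reach n.+1 K mu ->
  reach (n.+1 + m) (K * (1 + cost) ^+ pcount n.+1 (n.+1 + m))
    (mu - (pcount n.+1 (n.+1 + m))%:R * (4 / 3 / n%:R ^+ 2 * (7 / 4 * K))).
Proof.
move=> + R0; have n_ge' := nF_ge.
have pcountS k : pcount n.+1 (n.+1 + k.+1) = (pcount n.+1 (n.+1 + k) + prime (n.+1 + k))%N.
  rewrite /pcount addnS big_mkcond big_nat_recr ?leq_addr //= -big_mkcond /=.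
  by case: prime.
elim: m => [|m IH] mn; first by rewrite addn0 /pcount big_geq // expr0 mulr1 mul0r subr0.
have {IH}R := IH (ltnW mn).
have cnt_le : (pcount n.+1 (n.+1 + m) <= pcount n.+1 n.*2.+1)%N.
  by rewrite /pcount [leqRHS](big_cat_nat (n := n.+1 + m)) ?leq_addr //=; lia.
rewrite pcountS addnS; set j := pcount _ (_ + m) in R cnt_le *.
have [p_pr|np] := boolP (prime (n.+1 + m)); last first.
  by rewrite addn0; apply: reach_skip R => //; rewrite negb_and np.
have Kj : K * (1 + cost) ^+ j <= 7 / 4 * K by rewrite mulrC ler_wpM2r ?expr_cost_le.
have Kj0 : 0 <= K * (1 + cost) ^+ j.
  by rewrite mulr_ge0 // exprn_ge0 // addr_ge0 // divr_ge0; lra.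
apply: (reach_mono _ _ (reach_prime p_pr R)).
all: have -> : (n.+1 + m)%:R - 1 = (n + m)%:R :> F by rewrite addSn -natr1 addrK.
all: have a_ge : n%:R <= (n + m)%:R :> F by rewrite ler_nat leq_addr.
- have -> : (n.+1 + m)%:R = (n + m)%:R + 1 :> F by rewrite addSn natr1.
  set a : F := (n + m)%:R in a_ge *.
  rewrite addn1 (exprSr _ j) [leRHS]mulrA ler_wpM2l // lerD2l.
  (* At [p = a + 1] the relative growth is [4 / a + 8 / (3 a^2)], and [8 / (3 a) <= 1/100] since
     [a >= 300]. *)
  have ca : 401 / 100 <= cost * a by rewrite /cost mulrAC ler_pdivlMr; nra.
  rewrite ler_pdivrMr ?mulr_gt0 ?exprn_gt0; try lra.
  by rewrite expr2; nra.
- set a : F := (n + m)%:R in a_ge *.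
  rewrite addn1 -(natr1 j) mulrDl mul1r opprD addrA lerD2l lerN2.
  have -> : K * (1 + cost) ^+ j / (a ^+ 2 * (3 / 4)) =
     4 / 3 / a ^+ 2 * (K * (1 + cost) ^+ j) by field; lra.
  rewrite ler_pM ?divr_ge0 ?exprn_ge0 //; try lra.
  by rewrite ler_wpM2l ?lef_pV2 ?posrE ?exprn_gt0 ?lerXn2r ?nnegrE; lra.
Qed.

End Doubling.

(* Doubling costs less than [5 / 16 * K / n] and multiplies [K / n] by [7 / 8], so that
   [mu - 5 / 2 * K / n] does not decrease. *)
Lemma reach_double n (K : F) : (2 ^ 15 <= n)%N -> 0 <= K ->
  reach n.+1 K (1 / 100 + 5 / 2 * K / n%:R) ->
  reach n.*2.+1 (7 / 4 * K) (1 / 100 + 5 / 2 * (7 / 4 * K) / n.*2%:R).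
Proof.
move=> n_ge K0 R; have := reach_partial n_ge K0 (leqnn n) R.
have -> : (n.+1 + n = n.*2.+1)%N by rewrite addSn addnn.
apply: reach_mono; first by rewrite mulrC ler_wpM2r // expr_cost_le.
have n0 : 0 < n%:R :> F by rewrite ltr0n; apply: leq_trans n_ge; rewrite expn_gt0.
have cnt := pcount_doubling n_ge.
set t : F := (pcount _ _)%:R in cnt *.
have Kn : 0 <= K / n%:R by rewrite divr_ge0 // ltW.
(* The coefficient is [(2/15) (4/3) (7/4) = 14/45 < 5/16], and [5/16] is exactly the slack
   [5/2 - (5/2) (7/8)]. *)
have h : t * (4 / 3 / n%:R ^+ 2 * (7 / 4 * K)) <= 5 / 16 * (K / n%:R).
  have -> : t * (4 / 3 / n%:R ^+ 2 * (7 / 4 * K)) =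
     t / n%:R * (4 / 3 * (7 / 4)) * (K / n%:R) by field; lra.
  rewrite ler_wpM2r //.
  have : t / n%:R <= 2 / 15 by rewrite ler_pdivrMr.
  by move=> ?; lra.
have -> : 5 / 2 * (7 / 4 * K) / n.*2%:R = 5 / 2 * (7 / 8) * (K / n%:R).
  by rewrite -muln2 natrM; field; lra.
rewrite -mulrA; lra.
Qed.

Lemma reach_tail (K : F) n : (2 ^ 15 <= n)%N -> 0 <= K ->
  reach n.+1 K (1 / 100 + 5 / 2 * K / n%:R) ->
  forall i, exists N, (i <= N)%N /\ exists K', reach N K' (1 / 100).
Proof.
move=> n_ge K0 R i.
suff : exists m (K' : F), [/\ (i + 2 ^ 15 <= m)%N, 0 <= K' &
    reach m.+1 K' (1 / 100 + 5 / 2 * K' / m%:R)].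
  case=> m [K' [im K'0 R']]; exists m.+1; split; first by lia.
  exists K'; apply: (reach_mono _ _ R') => //.
  by rewrite lerDl divr_ge0 ?ler0n // mulr_ge0 //; lra.
elim: i => [|i [m [K' [im K'0 R']]]]; first by exists n, K.
have m_ge : (2 ^ 15 <= m)%N by apply: leq_trans im; apply: leq_addl.
exists m.*2, (7 / 4 * K'); split; last exact: reach_double.
  have : (0 < m)%N by apply: leq_trans m_ge; rewrite expn_gt0.
  by rewrite -addnn addSn; move: im; set T := (2 ^ 15)%N; lia.
by rewrite mulr_ge0 //; lra.
Qed.

End Tail.

(** * Contradiction and passage to the integers *)

(** Once all primes up to [Q] are processed the smooth part is [Q]; a covering would make the weight
    vanish everywhere, against a mean of at least [1/100]. *)
Lemma not_covering (F : realFieldType) (D : pred nat) (r : nat -> nat) (Q : nat) : 0 < Q ->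
  (forall d, D d -> 1 < d) -> (forall d, D d -> d %| Q) ->
  ~~ (2 %| Q) -> ~~ (9 %| Q) -> ~~ (15 %| Q) ->
  ~ (forall x, exists2 d, D d & x = r d %[mod d]).
Proof.
move=> Q_gt0 D_gt1 DQ Q2 Q9 Q15 cover.
have [K [n [K0 n_ge R]]] :=
  reach_sieve (reach_7 F r D_gt1 Q_gt0 Q2 Q9 Q15).
have [N [QN [K' [w]]]] := reach_tail n_ge K0 R Q.+1.
have -> : smooth_part Q N = Q.
  rewrite -[RHS]partnT //; apply: eq_in_partn => p; rewrite mem_primes => /and3P[_ _ pQ].
  by rewrite !inE (leq_ltn_trans (dvdn_leq Q_gt0 pQ) QN).
case=> _ _ w_unc mass _; have : (avg Q w = 0)%R.
  rewrite -[RHS](avg_const 0%R Q_gt0); apply: eq_avg => x _.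
  by have [d Dd xd] := cover x; apply: w_unc xd => //; apply: DQ.
by move: mass; lra.
Qed.

Lemma lcm_moduli_gt0 (D : {fset nat}) :
  (forall d, d \in D -> 1 < d) -> 0 < lcm_moduli D.
Proof.
move=> D_gt1; rewrite /lcm_moduli big_seq; apply: (big_ind (fun n => 0 < n)) => //.
  by move=> m n m0 n0; rewrite lcmn_gt0 m0.
by move=> d /D_gt1/ltnW.
Qed.

Lemma dvdn_lcm_moduli (D : {fset nat}) d : d \in D -> d %| lcm_moduli D.
Proof. by move=> dD; rewrite /lcm_moduli (big_rem d dD) dvdn_lcml. Qed.

Theorem theorem1p4 (D : {fset nat}) (a : nat -> int)
  (D_gt1 : forall d : nat, d \in D -> 1 < d)
  (D_cover : covers_integers D a) :
  2 %| lcm_moduli D \/ 9 %| lcm_moduli D \/ 15 %| lcm_moduli D.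
Proof.
have [|Q2] := boolP (2 %| _); first by left.
have [|Q9] := boolP (9 %| _); first by right; left.
have [|Q15] := boolP (15 %| _); first by right; right.
(* The residues are replaced by their nonnegative representatives, and only nonnegative integers are
   tested for being covered. *)
have [] := @not_covering rat (fun d => d \in D) (fun d => `|(a d %% d)%Z|%N) _
  (lcm_moduli_gt0 D_gt1) D_gt1 (@dvdn_lcm_moduli D) Q2 Q9 Q15.
move=> x; have : [set: int]%classic (Posz x) by [].
rewrite -D_cover => -[d /= dD [k _ xk]]; exists d => //.
have d0 : (Posz d != 0)%R by have := D_gt1 d dD; case: d {dD xk}.
apply/eqP; rewrite -eqz_nat -!modz_nat gez0_abs ?modz_ge0 // modz_mod.
by rewrite -xk mulrC addrC modzMDl.
Qed.
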